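(* Let $X$ be a Peano continuum and let $f:X\to X$ be a cw-expansive homeomorphism. Then $f$ has sensitive dependence on initial conditions, i.e. $f$ has no weak sinks: there is no point $x\in X$ such that $W^s_\varepsilon(x)$ is a neighborhood of $x$ for every $\varepsilon>0$.
   Context: A Peano continuum is a compact, connected, locally connected metric space $(X,d)$ with more than one point. A homeomorphism $f:X\to X$ of a compact metric space is continuum-wise expansive (cw-expansive) if there is a constant $\alpha>0$ such that $\sup_{n\in\mathbb Z}\operatorname{diam} f^n(C)>\alpha$ for every continuum $C\subset X$ containing more than one point. For $\varepsilon>0$ and $x\in X$: $W^s_\varepsilon(x)=\{y\in X:\ d(f^n(x),f^n(y))\le\varepsilon \text{ for all } n\ge 0\}$. A point $x$ is a weak sink if $W^s_\varepsilon(x)$ is a neighborhood of $x$ for every $\varepsilon>0$; $f$ is said to have sensitive dependence on initial conditions if it has no weak sinks. *)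

(* Defs.v *)
From HB Require Import structures.
From mathcomp Require Import all_boot all_order all_algebra.
From mathcomp Require Import all_classical all_reals all_analysis.
Set Implicit Arguments. Unset Strict Implicit. Unset Printing Implicit Defensive.
Import Order.TTheory GRing.Theory Num.Theory.
Local Open Scope classical_set_scope.
Local Open Scope ring_scope.

Definition locally_connected_space (T : topologicalType) : Prop :=
  forall (x : T) (U : set T), open U -> U x ->
    exists V : set T, [/\ open V, connected V, V x & V `<=` U].

Definition peano_continuum (R : realType) (X : metricType R) : Prop :=
  [/\ compact [set: X], connected [set: X], locally_connected_space X
    & exists x y : X, x <> y].

Definition continuum (T : topologicalType) (C : set T) : Prop :=
  [/\ C !=set0, compact C & connected C].

Definition homeo_with_inverse (X : topologicalType) (f g : X -> X) : Prop :=
  [/\ cancel f g, cancel g f, continuous f & continuous g].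

(* Integer iterates f^n, n : int, where g = f^{-1}. *)
Definition zpow_fun (X : Type) (f g : X -> X) (n : int) : X -> X :=
  match n with
  | Posz k => iter k f
  | Negz k => iter k.+1 g
  end.

(* diam A > a  <->  some pair of points of A is at distance > a
   (diam A = sup of distances). *)
Definition diam_gt (R : realType) (X : metricType R) (A : set X) (a : R) : Prop :=
  exists x y, [/\ A x, A y & a < mdist x y].

Definition cw_expansive (R : realType) (X : metricType R) (f g : X -> X) : Prop :=
  exists2 alpha : R, 0 < alpha &
    forall C : set X, continuum C -> (exists x y, [/\ C x, C y & x <> y]) ->
      exists n : int, diam_gt (zpow_fun f g n @` C) alpha.

Definition Ws (R : realType) (X : metricType R) (f : X -> X) (eps : R) (x : X) : set X :=
  [set y | forall n : nat, mdist (iter n f x) (iter n f y) <= eps].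

Definition weak_sink (R : realType) (X : metricType R) (f : X -> X) (x : X) : Prop :=
  forall eps : R, 0 < eps -> nbhs x (Ws f eps x).

(* Main.v *)
Require Import Defs.
From mathcomp Require Import all_boot all_order all_algebra.
From mathcomp Require Import all_classical all_reals all_analysis.
From mathcomp Require Import ring lra zify.
Set Implicit Arguments. Unset Strict Implicit. Unset Printing Implicit Defensive.
Import Order.TTheory GRing.Theory Num.Theory.
Local Open Scope classical_set_scope.
Local Open Scope ring_scope.

(** Replace continua by finite chains with small steps: an ultralimit of chains
    whose steps tend to 0 is a continuum, so cw-expansivity says that a fine
    chain of diameter at least [c] exceeds the size [alpha] within a bounded
    time.  Two consequences follow for a point [x] whose local stable set
    [W] is a neighborhood.  First, connected subsets of [W] containing [x] are
    uniformly contracted by forward iteration.  Second, there is [d > 0] such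
    that for every [r > 0] and all large [n], [f^n] maps the [d]-ball around
    [f^-n x] into the [r]-ball around [x]: otherwise, local connectedness yields
    a short chain from [f^-n x] whose [n]-th image leaves the [r]-ball, and an
    initial piece of it becomes macroscopic at some time before [n], yet never
    exceeds [alpha].

    Hence if [f^-i x] and [f^-j x] are [d]-close with [j] large, then
    [f^(j-i) x] is close to [x].  Near a weak sink [x] choose [y <> x] in the
    same stable neighborhood; by compactness [i] and [j] can be chosen for [x]
    and [y] simultaneously with [j - i] large, so [f^(j-i)] almost fixes both
    points while contracting their distance to 0, which is absurd. *)

(** * Metric preliminaries, ultrafilters and compactness *)

Definition closer (R : realType) (X : metricType R) (eta : R) : rel X :=
  fun u v => mdist u v < eta.

Lemma mdist_sym (R : realType) (X : metricType R) (x y : X) :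
  mdist x y = mdist y x.
Proof. exact: metric_sym. Qed.

Lemma mdist_triangle (R : realType) (X : metricType R) (x y z : X) :
  mdist x z <= mdist x y + mdist y z.
Proof. exact: metric_triangle. Qed.

Lemma closer_sym (R : realType) (X : metricType R) (eta : R) :
  symmetric (@closer R X eta).
Proof. by move=> u v; rewrite /closer mdist_sym. Qed.

Lemma nbhs_mdist_lt (R : realType) (X : metricType R) (x : X) (e : R) :
  0 < e -> nbhs x [set y | mdist x y < e].
Proof. by move=> e0; rewrite -ballEmdist; apply: nbhsx_ballx. Qed.

Lemma nbhs_mdist_ex (R : realType) (X : metricType R) (x : X) (A : set X) :
  nbhs x A -> exists2 e : R, 0 < e & forall y, mdist x y < e -> A y.
Proof.
move=> /nbhs_ballP[e /= e0 eA]; exists e => // y xy; apply: eA.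
by rewrite ballEmdist.
Qed.

Lemma open_mdist_lt (R : realType) (X : metricType R) (x : X) (e : R) :
  open [set y | mdist x y < e].
Proof.
rewrite openE => y /= xy; have xye : 0 < e - mdist x y by rewrite subr_gt0.
apply: filterS (nbhs_mdist_lt y xye) => z /= yz.
by have := mdist_triangle x y z; lra.
Qed.

(** One such [F] makes all sequences in a compact space converge simultaneously, without passing to
    subsequences. *)
Lemma exists_free_ultrafilter :
  exists2 F : set_system nat, UltraFilter F &
    forall A : set nat, (\forall k \near \oo, A k) -> F A.
Proof.
have [F [UF oF]] := @ultraFilterLemma nat (nbhs \oo) _.
by exists F.
Qed.

Lemma near_natSinv_lt (R : realType) (e : R) : 0 < e ->
  \forall k \near \oo, k.+1%:R^-1 < e.
Proof. by move=> e0; apply: (near_infty_natSinv_lt (PosNum e0)). Qed.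

Lemma compact_ultralimit (R : realType) (X : metricType R)
    (F : set_system nat) (u : nat -> X) :
  UltraFilter F -> compact [set: X] ->
  exists z : X, forall A : set X, nbhs z A -> F (u @^-1` A).
Proof.
move=> UF cX.
have [z [_ clz]] := cX (u @ F) _ filterT.
exists z => A zA.
have [//|FnA] := in_ultra_setVsetC (u @^-1` A) UF.
have FnA' : (u @ F) (~` A) by [].
by have [y []] := clz _ _ FnA' zA.
Qed.

(** A Lebesgue number argument: pairs violating [Q] at distance below 1/(k+1) would have a common
    ultralimit [z], and some pair would lie in the neighborhood supplied for [z]. *)
Lemma compact_near_diagonal (R : realType) (X : metricType R)
    (Q : X -> X -> Prop) : compact [set: X] ->
  (forall z : X, exists2 A : set X, nbhs z A & forall u v, A u -> A v -> Q u v) ->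
  exists2 d : R, 0 < d & forall u v, mdist u v < d -> Q u v.
Proof.
move=> cX zQ; apply: contrapT => /forall2NP nQ.
have /choice[w wP] : forall k : nat, exists w : X * X,
    mdist w.1 w.2 < k.+1%:R^-1 /\ ~ Q w.1 w.2.
  move=> k; have [|] := nQ k.+1%:R^-1; first by rewrite invr_gt0 ltr0n.
  by move=> /existsNP[u] /existsNP[v] /not_implyP[uv nQuv]; exists (u, v).
have [F UF oF] := exists_free_ultrafilter.
have [z zP] := compact_ultralimit (fun k => (w k).1) UF cX.
have [A /nbhs_mdist_ex[e e0 eA] AQ] := zQ z.
have e20 : 0 < e / 2 by rewrite divr_gt0.
have [k [/= zk ke]] := filter_ex (filterI (zP _ (nbhs_mdist_lt z e20))
  (oF _ (near_natSinv_lt e20))).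
have [wk nQk] := wP k; apply: nQk.
have {}wk := lt_trans wk ke.
apply: AQ; apply: eA; first by lra.
by have := mdist_triangle z (w k).1 (w k).2; lra.
Qed.

Lemma uniform_continuity (R : realType) (X : metricType R) (h : X -> X) (e : R) :
  compact [set: X] -> continuous h -> 0 < e ->
  exists2 d : R, 0 < d & forall u v, mdist u v < d -> mdist (h u) (h v) < e.
Proof.
move=> cX hc e0.
apply: (@compact_near_diagonal _ _ (fun u v => mdist (h u) (h v) < e)) => // z.
have e20 : 0 < e / 2 by rewrite divr_gt0.
exists (h @^-1` [set y | mdist (h z) y < e / 2]).
  exact: hc (nbhs_mdist_lt (h z) e20).
move=> u v /= zu zv; have := mdist_triangle (h u) (h z) (h v).
by rewrite (mdist_sym (h u) (h z)); lra.
Qed.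

Lemma iter_continuous (T : topologicalType) (h : T -> T) (n : nat) :
  continuous h -> continuous (iter n h).
Proof.
move=> hc; elim: n => [|n IH] x; first exact: cvg_id.
exact: continuous_comp (IH x) (hc _).
Qed.

Lemma uniform_continuity_iter (R : realType) (X : metricType R) (h : X -> X)
    (e : R) (n : nat) :
  compact [set: X] -> continuous h -> 0 < e ->
  exists2 d : R, 0 < d & forall u v, mdist u v < d ->
    forall j, (j <= n)%N -> mdist (iter j h u) (iter j h v) < e.
Proof.
move=> cX hc e0; elim: n => [|n [d d0 dP]].
  by exists e => // u v uv j; rewrite leqn0 => /eqP ->.
have [d' d'0 d'P] := uniform_continuity cX (iter_continuous (n := n.+1) hc) e0.
exists (Num.min d d') => [|u v]; first by rewrite lt_min d0.
rewrite lt_min => /andP[uv uv'] j; rewrite leq_eqVlt => /orP[/eqP ->|].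
  exact: d'P.
exact: dP.
Qed.

Lemma uniform_local_connectedness (R : realType) (X : metricType R) (d : R) :
  compact [set: X] -> locally_connected_space X -> 0 < d ->
  exists2 d' : R, 0 < d' & forall u v : X, mdist u v < d' ->
    exists G : set X, [/\ connected G, G u, G v &
      forall a b, G a -> G b -> mdist a b < d].
Proof.
move=> cX lX d0; apply: compact_near_diagonal => // z.
have d20 : 0 < d / 2 by rewrite divr_gt0.
have zz : [set y | mdist z y < d / 2] z by rewrite /= mdistxx.
have [G [oG cG Gz Gd]] := lX z _ (open_mdist_lt z (d / 2)) zz.
exists G; first exact: open_nbhs_nbhs.
move=> u v Gu Gv; exists G; split => // a b /Gd + /Gd.
rewrite /= => za zb; have := mdist_triangle a z b.
by rewrite (mdist_sym a z); lra.
Qed.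

(** * Finite chains and their crossings *)

Lemma connected_chain (R : realType) (X : metricType R) (G : set X) (u v : X)
    (eta : R) : 0 < eta -> connected G -> G u -> G v ->
  exists p, [/\ path (@closer R X eta) u p, last u p = v
    & forall w, w \in u :: p -> G w].
Proof.
move=> eta0 cG Gu Gv.
pose B := [set w | exists p, [/\ path (@closer R X eta) u p, last u p = w
    & forall w, w \in u :: p -> G w]].
have BG w : B w -> G w.
  by move=> [p [_ <- pG]]; apply: pG; exact: mem_last.
have stepB a b : B a -> G b -> mdist a b < eta -> B b.
  move=> [p [up pa pG]] Gb ab; exists (rcons p b); split.
  - by rewrite rcons_path up pa.
  - by rewrite last_rcons.
  - by move=> w; rewrite -rcons_cons mem_rcons inE => /orP[/eqP ->|/pG].
(* The set [B] of endpoints of chains is relatively clopen in [G]: by [stepB] it absorbs every point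
   of [G] within [eta] of it. *)
suff BE : B = G by rewrite -BE in Gv; exact: Gv.
apply: cG.
- by exists u, [::]; split => // w; rewrite inE => /eqP ->.
- exists (\bigcup_(a in B) [set b | mdist a b < eta]).
    by apply: bigcup_open => a _; exact: open_mdist_lt.
  apply/seteqP; split => [b Bb|b [Gb [a Ba]]].
    by split; [exact: BG|exists b; rewrite //= mdistxx].
  exact: stepB.
- exists (closure B); first exact: closed_closure.
  apply/seteqP; split => [b Bb|b [Gb /(_ _ (nbhs_mdist_lt b eta0))[a [Ba /= ba]]]].
    by split; [exact: BG|exact: subset_closure].
  by apply: (stepB a) => //; rewrite mdist_sym.
Qed.

Lemma path_crossing (T : eqType) (e : rel T) (P : T -> Prop) (x : T) (p : seq T)
    (u v : T) : symmetric e -> path e x p ->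
  u \in x :: p -> v \in x :: p -> P u -> ~ P v ->
  exists a b, [/\ a \in x :: p, b \in x :: p, e a b, P a & ~ P b].
Proof.
move=> se xp up vp Pu nPv; apply: contrapT => nC.
suff cst w : w \in x :: p -> (P w <-> P x).
  by apply: nPv; apply/(cst v vp); apply/(cst u up).
move: xp nC {up vp}; elim: p x => [|y p IH] x /=.
  by move=> _ _; rewrite inE => /eqP ->.
move=> /andP[exy yp] nC.
have yx : P y <-> P x.
  split => [Py|Px]; apply: contrapT => n; apply: nC.
    by exists y, x; rewrite se !inE !eqxx ?orbT.
  by exists x, y; rewrite !inE !eqxx ?orbT.
rewrite inE => /orP[/eqP -> //|wp]; rewrite -yx; apply: IH => //.
move=> [a [b [ap bp eab Pa Pb]]]; apply: nC; exists a, b.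
by split => //; rewrite inE (ap, bp) orbT.
Qed.

(** Keeping the hit [w] apart from [q] lets a bound that holds before the hit extend to [w] at the
    cost of one step. *)
Lemma path_first_hit (T : eqType) (e : rel T) (P : T -> Prop) (x : T)
    (p : seq T) (u : T) : path e x p -> ~ P x -> u \in x :: p -> P u ->
  exists q w, [/\ path e x (rcons q w), {subset rcons q w <= p},
    forall y, y \in x :: q -> ~ P y & P w].
Proof.
elim: p x => [|y p IH] x /=; first by rewrite inE => _ nPx /eqP -> /nPx.
move=> /andP[exy yp] nPx; rewrite inE => /orP[/eqP -> /nPx//|uyp Pu].
have [Py|nPy] := pselect (P y).
  exists [::], y; split => //=; first by rewrite exy.
    by move=> a; rewrite !inE => ->.
  by move=> a; rewrite inE => /eqP ->.
have [q [w [yq qp nq Pw]]] := IH y yp nPy uyp Pu.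
exists (y :: q), w; split => //=; first by rewrite exy.
  by move=> a; rewrite !inE => /orP[->//|/qp ->]; rewrite orbT.
by move=> a; rewrite inE => /orP[/eqP -> //|/nq].
Qed.

(** * Ultralimits of sets and of chains *)

Definition ultralimit_set (T : topologicalType) (F : set_system nat)
    (A : nat -> set T) : set T :=
  [set z | forall B : set T, nbhs z B -> F [set k | A k `&` B !=set0]].

Lemma ultralimit_set_mem (T : topologicalType) (F : set_system nat)
    (A : nat -> set T) (u : nat -> T) (z : T) : UltraFilter F ->
  F [set k | A k (u k)] -> (forall B, nbhs z B -> F (u @^-1` B)) ->
  ultralimit_set F A z.
Proof.
move=> UF FA uz B zB; apply: filterS (filterI FA (uz _ zB)) => k [Au Bu].
by exists (u k).
Qed.

Lemma closed_ultralimit_set (T : topologicalType) (F : set_system nat)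
    (A : nat -> set T) : UltraFilter F -> closed (ultralimit_set F A).
Proof.
move=> UF z clz B zB.
have [w [Lw Bw]] := clz _ (nbhs_interior zB).
exact: Lw.
Qed.

(* A separation of the limit would be crossed by ever shorter steps of the
   chains, whose endpoints converge to a common point of the limit. *)
Lemma connected_ultralimit_chain (R : realType) (X : metricType R)
    (F : set_system nat) (x : nat -> X) (p : nat -> seq X) :
  UltraFilter F -> (forall A : set nat, (\forall k \near \oo, A k) -> F A) ->
  compact [set: X] -> (forall k, path (@closer R X k.+1%:R^-1) (x k) (p k)) ->
  connected (ultralimit_set F (fun k => [set` x k :: p k])).
Proof.
move=> UF oF cX xp; set A := fun k => [set` x k :: p k].
set L := ultralimit_set F A.
move=> B [b Bb] [V oV BV] [C clC BC].
apply: contrapT => BL.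
have cL : closed L by exact: closed_ultralimit_set.
have [q [Lq nBq]] : exists q, L q /\ ~ B q.
  apply: contrapT => nq; apply: BL; apply/seteqP; split => [y|y Ly].
    by rewrite BV => -[].
  by apply: contrapT => nBy; apply: nq; exists y.
have clB : closed B by rewrite BC; exact: closedI.
have clQ : closed (L `\` B).
  suff -> : L `\` B = L `&` ~` V by apply: closedI => //; exact: open_closedC.
  apply/seteqP; split => [y [Ly nBy]|y [Ly nVy]]; split => //.
    by move=> Vy; apply: nBy; rewrite BV.
  by rewrite BV => -[].
have [U [W [oU oW BU QW UW]]] :
    exists U W, [/\ open U, open W, B `<=` U, L `\` B `<=` W & U `&` W = set0].
  have /(@normal_openP R) nX := @pseudometric_normal R X.
  apply: nX => //.
  by apply/seteqP; split => // y [? []].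
have nUW y : U y -> ~ W y by move=> Uy Wy; have : (U `&` W) y by []; rewrite UW.
have FU : F [set k | A k `&` U !=set0].
  have Lb : L b by move: Bb; rewrite BV => -[].
  by apply: Lb; apply: open_nbhs_nbhs; split => //; exact: BU.
have FW : F [set k | A k `&` W !=set0].
  by apply: (Lq); apply: open_nbhs_nbhs; split => //; apply: QW; split.
(* A chain meeting both [U] and [W] has a step from [w.1] outside [U] to [w.2] inside. Elsewhere
   [(b, b)] is a dummy value; [FUW] discards those [k]. *)
have /choice[w wP] : forall k : nat, exists w : X * X,
    A k `&` U !=set0 -> A k `&` W !=set0 ->
    [/\ A k w.1, mdist w.1 w.2 < k.+1%:R^-1, U w.2 & ~ U w.1].
  move=> k; have [[[a [Aa Ua]] [c [Ac Wc]]]|n] :=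
    pselect (A k `&` U !=set0 /\ A k `&` W !=set0); last first.
    by exists (b, b) => ? ?; exfalso; apply: n.
  have [//|u [v [up vp uv Uu nUv]]] :=
    path_crossing (@closer_sym R X _) (xp k) Aa Ac Ua _.
    by move=> /nUW.
  by exists (v, u) => _ _ /=; split => //; rewrite mdist_sym.
have FUW : F [set k | A k `&` U !=set0 /\ A k `&` W !=set0] by exact: filterI.
have [z zP] := compact_ultralimit (fun k => (w k).1) UF cX.
have Lz : L z.
  apply: (ultralimit_set_mem (u := fun k => (w k).1)) => //.
  apply: filterS FUW => k [k1 k2].
  by have [] := wP k k1 k2.
have nUz : ~ U z.
  move=> Uz; have [k [[k1 k2] k3]] :=
    filter_ex (filterI FUW (zP U (open_nbhs_nbhs (conj oU Uz)))).
  by have [_ _ _] := wP k k1 k2; exact.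
(* Since [w.2] is asymptotic to [w.1], it enters the open set [W] around [z], although it lies in
   [U]. *)
have Wz : W z by apply: QW; split => // /BU.
have [e e0 eW] := nbhs_mdist_ex (open_nbhs_nbhs (conj oW Wz)).
have e20 : 0 < e / 2 by rewrite divr_gt0.
have [k [[[k1 k2] /= zk] ke]] := filter_ex (filterI (filterI FUW
  (zP _ (nbhs_mdist_lt z e20))) (oF _ (near_natSinv_lt e20))).
have [_ wk Uk _] := wP k k1 k2; have {}wk := lt_trans wk ke.
apply: (nUW _ Uk); apply: eW.
by have := mdist_triangle z (w k).1 (w k).2; lra.
Qed.

(** * Expansivity of fine chains *)

Lemma zpow_fun_continuous (T : topologicalType) (f g : T -> T) (n : int) :
  continuous f -> continuous g -> continuous (zpow_fun f g n).
Proof.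
move=> fc gc; case: n => n; first exact: (iter_continuous (n := n)).
exact: (iter_continuous (n := n.+1)).
Qed.

Definition cw_expansive_const (R : realType) (X : metricType R) (f g : X -> X)
    (alpha : R) : Prop :=
  forall C : set X, continuum C -> (exists x y, [/\ C x, C y & x <> y]) ->
    exists n : int, diam_gt (zpow_fun f g n @` C) alpha.

(** Otherwise there are chains with steps below 1/(k+1), of diameter at least [c], whose iterates at
    times up to [k] in absolute value stay within [alpha]. Their ultralimit is a nondegenerate
    continuum violating expansivity. *)
Lemma chain_cw_expansive (R : realType) (X : metricType R) (f g : X -> X)
    (alpha c : R) :
  compact [set: X] -> continuous f -> continuous g -> 0 < c ->
  cw_expansive_const f g alpha ->
  exists N : nat, exists2 eta : R, 0 < eta &
    forall x p u v, path (@closer R X eta) x p ->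
      u \in x :: p -> v \in x :: p -> c <= mdist u v ->
      exists (n : int) a b, [/\ (`|n| <= N)%N, a \in x :: p, b \in x :: p
        & alpha < mdist (zpow_fun f g n a) (zpow_fun f g n b)].
Proof.
move=> cX fc gc c0 cw; apply: contrapT => /forallNP nU.
have /choice[s sP] : forall k : nat, exists s : (X * seq X) * (X * X),
    [/\ path (@closer R X k.+1%:R^-1) s.1.1 s.1.2,
      s.2.1 \in s.1.1 :: s.1.2, s.2.2 \in s.1.1 :: s.1.2,
      c <= mdist s.2.1 s.2.2
    & forall (n : int) a b, (`|n| <= k)%N -> a \in s.1.1 :: s.1.2 ->
      b \in s.1.1 :: s.1.2 ->
      mdist (zpow_fun f g n a) (zpow_fun f g n b) <= alpha].
  move=> k; have /forall2NP := nU k.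
  move=> /(_ k.+1%:R^-1)[|]; first by rewrite invr_gt0 ltr0n.
  move=> /existsNP[x] /existsNP[p] /existsNP[u] /existsNP[v].
  move=> /not_implyP[xp] /not_implyP[ux] /not_implyP[vx] /not_implyP[cuv n].
  exists ((x, p), (u, v)); split => // m a b mk ax bx.
  by rewrite leNgt; apply/negP => lt; apply: n; exists m, a, b.
have [F UF oF] := exists_free_ultrafilter.
pose A k := [set` (s k).1.1 :: (s k).1.2].
have [a aP] := compact_ultralimit (fun k => (s k).2.1) UF cX.
have [b bP] := compact_ultralimit (fun k => (s k).2.2) UF cX.
have La : ultralimit_set F A a.
  apply: (ultralimit_set_mem (u := fun k => (s k).2.1)) => //.
  by apply: filterS filterT => k _; have [] := sP k.
have Lb : ultralimit_set F A b.
  apply: (ultralimit_set_mem (u := fun k => (s k).2.2)) => //.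
  by apply: filterS filterT => k _; have [] := sP k.
have [||n [_ [_ [[z Lz <-] [w Lw <-]]]]] := cw (ultralimit_set F A).
- split; first by exists a.
    apply: (subclosed_compact _ cX) => //; exact: closed_ultralimit_set.
  by apply: connected_ultralimit_chain => // k; have [] := sP k.
- exists a, b; split => // ab.
  have c20 : 0 < c / 2 by rewrite divr_gt0.
  have [k [/= ak bk]] := filter_ex (filterI (aP _ (nbhs_mdist_lt a c20))
    (bP _ (nbhs_mdist_lt b c20))).
  have [_ _ _ + _] := sP k; rewrite -{}ab in bk.
  have := mdist_triangle (s k).2.1 a (s k).2.2.
  by rewrite (mdist_sym _ a); lra.
(* The bound by [alpha] on the chains with [k] at least [|n|] passes to the limit points [z] and
   [w], up to an arbitrary [e]. *)
apply/negP; rewrite -leNgt; apply/ler_addgt0Pr => e e0.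
have hc := @zpow_fun_continuous _ _ _ n fc gc.
have e20 : 0 < e / 2 by rewrite divr_gt0.
have [k [[[y [Ay /= zy]] [y' [Ay' /= wy]]] kn]] := filter_ex (filterI (filterI
  (Lz _ (hc z _ (nbhs_mdist_lt (zpow_fun f g n z) e20)))
  (Lw _ (hc w _ (nbhs_mdist_lt (zpow_fun f g n w) e20))))
  (oF _ (nbhs_infty_ge `|n|%N))).
have [_ _ _ _ /(_ n y y' kn Ay Ay') yy'] := sP k.
have t1 := mdist_triangle (zpow_fun f g n z) (zpow_fun f g n y) (zpow_fun f g n w).
have t2 := mdist_triangle (zpow_fun f g n y) (zpow_fun f g n y') (zpow_fun f g n w).
by move: t2; rewrite (mdist_sym (zpow_fun f g n y') (zpow_fun f g n w)); lra.
Qed.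

Lemma iter_cancel (T : Type) (f g : T -> T) (n : nat) :
  cancel f g -> cancel (iter n f) (iter n g).
Proof. by move=> fK; elim: n => // n IH u; rewrite iterSr iterS fK IH. Qed.

Lemma zpow_fun_iter (T : Type) (f g : T -> T) (k : int) (n : nat) :
  cancel f g -> (`|k| <= n)%N ->
  exists m, forall u, zpow_fun f g k (iter n f u) = iter m f u.
Proof.
move=> fK; case: k => k /= kn; first by exists (k + n)%N => u; rewrite iterD.
exists (n - k.+1)%N => u; rewrite -[in LHS](subnKC kn) iterD.
by rewrite -/(iter k.+1 g _) (iter_cancel k.+1 fK).
Qed.

(** The expansion time is at most [N] in absolute value, so counted from time [n >= N] it is still a
    forward time of the original chain. *)
Lemma chain_forward_expansion (R : realType) (X : metricType R) (f g : X -> X)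
    (alpha c : R) :
  compact [set: X] -> homeo_with_inverse f g -> cw_expansive_const f g alpha ->
  0 < c ->
  exists N : nat, exists2 eta : R, 0 < eta & forall n x p u v, (N <= n)%N ->
    path (@closer R X eta) (iter n f x) (map (iter n f) p) ->
    u \in x :: p -> v \in x :: p -> c <= mdist (iter n f u) (iter n f v) ->
    exists m a b, [/\ a \in x :: p, b \in x :: p
      & alpha < mdist (iter m f a) (iter m f b)].
Proof.
move=> cX [fK _ fc gc] cw c0.
have [N [eta eta0 H]] := chain_cw_expansive cX fc gc c0 cw.
exists N, eta => // n x p u v Nn xp ux vx cuv.
have [k [_ [_ [kN /(mapP (s := x :: p))[a ax ->] /(mapP (s := x :: p))[b bx ->] lt]]]] :=
  H _ _ _ _ xp (map_f (iter n f) ux) (map_f (iter n f) vx) cuv.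
have [m mE] := zpow_fun_iter fK (leq_trans kN Nn).
by exists m, a, b; rewrite -!mE.
Qed.

(** * Dynamics on local stable sets *)

Lemma Ws_center_shift (R : realType) (X : metricType R) (f : X -> X) (e : R)
    (x y z : X) : Ws f e x y -> Ws f e x z -> Ws f (e + e) y z.
Proof.
move=> xy xz n; have := mdist_triangle (iter n f y) (iter n f x) (iter n f z).
by have := xy n; have := xz n; rewrite (mdist_sym _ (iter n f x)); lra.
Qed.

(** If the images of [x] and [y] were far apart at a late time, a fine chain inside [V] would expand
    beyond [alpha], while points of [V] always stay within twice [alpha / 2] of each other. *)
Lemma Ws_connected_contraction (R : realType) (X : metricType R) (f g : X -> X)
    (alpha e : R) (x : X) (V : set X) :
  compact [set: X] -> homeo_with_inverse f g -> cw_expansive_const f g alpha ->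
  connected V -> V x -> V `<=` Ws f (alpha / 2) x -> 0 < e ->
  exists N, forall n y, (N <= n)%N -> V y -> mdist (iter n f x) (iter n f y) < e.
Proof.
move=> cX fg cw cV Vx VW e0.
have [N [eta eta0 H]] := chain_forward_expansion cX fg cw e0.
exists N => n y Nn Vy; rewrite ltNge; apply/negP => le.
have [_ _ fc _] := fg.
have [d d0 dP] := uniform_continuity cX (iter_continuous (n := n) fc) eta0.
have [p [xp py pV]] := connected_chain d0 cV Vx Vy.
have yp : y \in x :: p by rewrite -py mem_last.
have [|m [a [b [/pV/VW ax /pV/VW bx]]]] := H n x p x y Nn _ (mem_head _ _) yp le.
  by apply: homo_path xp => u v; exact: dP.
by have := Ws_center_shift ax bx m; lra.
Qed.

(** That [d] precedes [r] is essential. It comes only from the scale [alpha / 4]: [d]-close points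
    lie in a connected set whose first [N1] iterates stay below that scale. *)
Lemma Ws_nbhs_backward_ball (R : realType) (X : metricType R) (f g : X -> X)
    (alpha : R) (x : X) :
  compact [set: X] -> locally_connected_space X ->
  homeo_with_inverse f g -> 0 < alpha -> cw_expansive_const f g alpha ->
  nbhs x (Ws f (alpha / 2) x) ->
  exists2 d : R, 0 < d & forall r, 0 < r -> exists N, forall n z, (N <= n)%N ->
    mdist (iter n g x) z < d -> mdist x (iter n f z) < r.
Proof.
move=> cX lX fg alpha0 cw /nbhs_mdist_ex[r1 r10 r1W].
have [_ gK fc _] := fg.
have alpha40 : 0 < alpha / 4 by rewrite divr_gt0.
have [N1 [eta1 eta10 H1]] := chain_forward_expansion cX fg cw alpha40.
have [d1 d10 d1P] := uniform_continuity_iter N1 cX fc alpha40.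
have [d d0 dP] := uniform_local_connectedness cX lX d10.
exists d => // r0 r00.
(* The slack [r + r <= r1] lets the last point of the cut chain overshoot the [r]-ball by one step
   and remain in the stable neighborhood. *)
have [r [rp rr0 rr1]] : exists r, [/\ 0 < r, r <= r0 & r + r <= r1].
  exists (Num.min (r0 / 2) (r1 / 2)); rewrite lt_min !divr_gt0 //=.
  by have [h|h] := leP (r0 / 2) (r1 / 2); split => //; lra.
have [N2 [eta2 eta20 H2]] := chain_forward_expansion cX fg cw rp.
exists N2 => n z Nn; set y := iter n g x => yz.
rewrite ltNge; apply/negP => rz.
have yn : iter n f y = x by exact: iter_cancel.
have [G [cG Gy Gz Gd]] := dP y z yz.
(* Besides fineness for both expansion lemmas, one step must cost at most [r] at the first cut and
   [alpha / 4] at the second. *)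
pose eta := Num.min (Num.min eta1 eta2) (Num.min (alpha / 4) r).
have [eta0 le1 le2 le3 le4] : [/\ 0 < eta, eta <= eta1, eta <= eta2,
    eta <= alpha / 4 & eta <= r].
  by rewrite /eta !lt_min !ge_min !lexx !orbT eta10 eta20 alpha40 rp.
have [d3 d30 d3P] := uniform_continuity_iter n cX fc eta0.
have fine e' j x' p' : eta <= e' -> (j <= n)%N -> path (@closer R X d3) x' p' ->
    path (@closer R X e') (iter j f x') (map (iter j f) p').
  move=> le jn; apply: homo_path => u v uv.
  by apply: lt_le_trans le; exact: d3P.
have [p [yp pz pG]] := connected_chain d30 cG Gy Gz.
have zp : z \in y :: p by rewrite -pz mem_last.
(* Cut the chain from [y] to [z] where its [n]-th image first leaves the ball
   of radius [r]: the image of the piece stays in the stable set of [x]. *)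
have [||q [w [yq qp qr wr]]] :=
  @path_first_hit _ _ (fun u => r <= mdist x (iter n f u)) _ _ z yp _ zp.
- by rewrite yn mdistxx; apply/negP; rewrite -ltNge.
- exact: le_trans rz.
have qW u : u \in y :: rcons q w -> Ws f (alpha / 2) x (iter n f u).
  rewrite -rcons_cons mem_rcons inE => /orP[/eqP ->|/qr/negP]; last first.
    by rewrite -ltNge => ur; apply: r1W; lra.
  apply: r1W; move: yq; rewrite rcons_path => /andP[_ lw].
  have := d3P _ _ lw n (leqnn n); have /negP := qr _ (mem_last y q).
  rewrite -ltNge; have := mdist_triangle x (iter n f (last y q)) (iter n f w).
  by lra.
have qG u : u \in y :: rcons q w -> G u.
  rewrite inE => /orP[/eqP -> //|/qp up]; apply: pG.
  by rewrite inE up orbT.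
(* From time [n] on, the orbits are controlled by the stable set of [x], which is the [n]-th image
   of [y]. *)
have late m u : (n <= m)%N -> u \in y :: rcons q w ->
    mdist (iter m f y) (iter m f u) <= alpha / 2.
  by move=> nm /qW /(_ (m - n)%N); rewrite -{1}yn -!iterD subnK.
pose P u := exists2 j, (j <= n)%N & alpha / 4 <= mdist (iter j f y) (iter j f u).
(* If no point became macroscopic by time [n], all would stay within [alpha / 2] of [y] at every
   time, against the expansion forced by the exit from the [r]-ball. *)
have [v vq Pv] : exists2 v, v \in y :: rcons q w & P v.
  apply: contrapT => nP.
  have wq : w \in y :: rcons q w by rewrite inE mem_rcons mem_head orbT.
  have rw : r <= mdist (iter n f y) (iter n f w) by rewrite yn.
  have [m [a [b [aq bq]]]] :=
    H2 n y _ y w Nn (fine _ _ _ _ le2 (leqnn n) yq) (mem_head _ _) wq rw.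
  have half u : u \in y :: rcons q w ->
      mdist (iter m f y) (iter m f u) <= alpha / 2.
    move=> uq; have [nm|mn] := leqP n m; first exact: late.
    rewrite leNgt; apply/negP => lt; apply: nP; exists u => //.
    by exists m; [exact: ltnW|lra].
  have := half _ aq; have := half _ bq.
  have := mdist_triangle (iter m f a) (iter m f y) (iter m f b).
  by rewrite (mdist_sym _ (iter m f y)); lra.
(* Cut again, where the chain first becomes macroscopic at some time before
   [n]: the resulting piece violates expansivity. *)
have [|q2 [w2 [yq2 q2q q2P [j jn wj]]]] := @path_first_hit _ _ P _ _ v yq _ vq Pv.
  by move=> [j _]; rewrite mdistxx; lra.
have q2q' u : u \in y :: rcons q2 w2 -> u \in y :: rcons q w.
  by rewrite !(inE, in_cons) => /orP[->//|/q2q ->]; rewrite orbT.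
have small m u : u \in y :: rcons q2 w2 ->
    mdist (iter m f y) (iter m f u) <= alpha / 2.
  move=> uq2; have [nm|mn] := leqP n m; first by apply: late => //; exact: q2q'.
  have nPs u' : u' \in y :: q2 -> mdist (iter m f y) (iter m f u') < alpha / 4.
    move=> /q2P nP; rewrite ltNge; apply/negP => le; apply: nP.
    by exists m => //; exact: ltnW.
  move: uq2; rewrite -rcons_cons mem_rcons inE => /orP[/eqP ->|/nPs]; last by lra.
  move: yq2; rewrite rcons_path => /andP[_ lw].
  have := d3P _ _ lw m (ltnW mn); have := nPs _ (mem_last y q2).
  by have := mdist_triangle (iter m f y) (iter m f (last y q2)) (iter m f w2); lra.
have w2q : w2 \in y :: rcons q2 w2 by rewrite inE mem_rcons mem_head orbT.
(* Early times are excluded by the smallness of [G]; at a later [j], the size [alpha / 4] forces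
   expansion beyond [alpha], against [small]. *)
have [jN1|N1j] := leqP j N1.
  have := d1P _ _ (Gd _ _ Gy (qG _ (q2q' _ w2q))) j jN1; lra.
have [m [a [b [aq bq]]]] := H1 j y _ y w2 (ltnW N1j)
  (fine _ _ _ _ le1 jn yq2) (mem_head _ _) w2q wj.
have := small m _ aq; have := small m _ bq.
have := mdist_triangle (iter m f a) (iter m f y) (iter m f b).
by rewrite (mdist_sym _ (iter m f y)); lra.
Qed.

(** * A second point near the sink, and the contradiction *)

Lemma connected_open_not_singleton (R : realType) (X : metricType R)
    (V : set X) (x : X) :
  connected [set: X] -> (exists a b : X, a <> b) -> open V -> V x ->
  exists2 y, V y & x <> y.
Proof.
move=> cX [a [b ab]] oV Vx; apply: contrapT => nV; apply: ab.
have V1 : V = [set x].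
  apply/seteqP; split => [y Vy /=|_ -> //].
  by apply: contrapT => nyx; apply: nV; exists y => // xy; apply: nyx.
have VT : V = setT.
  apply: cX; first by exists x.
    by exists V => //; rewrite setTI.
  exists V; last by rewrite setTI.
  rewrite V1; apply: accessible_closed_set1.
  by apply: hausdorff_accessible; exact: metric_hausdorff.
have eqx c : c = x by have : V c by [rewrite VT]; rewrite V1.
by rewrite (eqx a) (eqx b).
Qed.

Theorem theorem2 (R : realType) (X : metricType R) (f g : X -> X) :
  peano_continuum X -> homeo_with_inverse f g -> cw_expansive f g ->
  ~ exists x : X, weak_sink f x.
Proof.
move=> [cX connX lX X2] fg [alpha alpha0 cw] [x sx].
have alpha40 : 0 < alpha / 4 by rewrite divr_gt0.
have [V [oV cV Vx VW]] := lX x _ (open_interior _) (sx _ alpha40).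
have {}VW : V `<=` Ws f (alpha / 4) x := subset_trans VW (@interior_subset _ _).
have [y Vy xy] := connected_open_not_singleton connX X2 oV Vx.
(* Starting from [alpha / 4] makes [V] part of the [alpha / 2] stable set of each of its points, so
   [y] can play the same role as [x]. *)
have a2 : alpha / 4 + alpha / 4 = alpha / 2 by lra.
have VW2 z : V z -> V `<=` Ws f (alpha / 2) z.
  by move=> Vz w Vw; rewrite -a2; apply: Ws_center_shift (VW _ Vz) (VW _ Vw).
have nW z : V z -> nbhs z (Ws f (alpha / 2) z).
  by move=> Vz; apply: filterS (VW2 _ Vz) _; exact: open_nbhs_nbhs.
have [dx dx0 dxP] := Ws_nbhs_backward_ball cX lX fg alpha0 cw (nW _ Vx).
have [dy dy0 dyP] := Ws_nbhs_backward_ball cX lX fg alpha0 cw (nW _ Vy).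
(* The final triangle inequality has three terms, each below a third of [mdist x y]. *)
have r0 : 0 < mdist x y / 3 by rewrite divr_gt0 // mdist_gt0; exact/eqP.
have [Nx NxP] := dxP _ r0; have [Ny NyP] := dyP _ r0.
have [N0 N0P] := Ws_connected_contraction cX fg cw cV Vx (VW2 _ Vx) r0.
have [F UF oF] := exists_free_ultrafilter.
have [p pP] := compact_ultralimit (fun k => iter k g x) UF cX.
have [q qP] := compact_ultralimit (fun k => iter k g y) UF cX.
have dx20 : 0 < dx / 2 by rewrite divr_gt0.
have dy20 : 0 < dy / 2 by rewrite divr_gt0.
have Fpq := filterI (pP _ (nbhs_mdist_lt p dx20)) (qP _ (nbhs_mdist_lt q dy20)).
(* Using the same [F] for both backward orbits yields common return times. Fixing [i] first allows
   [j] to be taken so large that [j - i >= N0]. *)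
have [i [/= pxi qyi]] := filter_ex (Fpq _).
have [j [[/= pxj qyj] ij]] := filter_ex (filterI (Fpq _)
  (oF _ (nbhs_infty_ge (Nx + Ny + N0 + i)%N))).
have [Nxj Nyj N0j {}ij] :
    [/\ (Nx <= j)%N, (Ny <= j)%N, (N0 <= j - i)%N & (i <= j)%N].
  by move: ij; clear; split; lia.
have [_ gK _ _] := fg.
have back u : iter j f (iter i g u) = iter (j - i) f u.
  by rewrite -{1}(subnK ij) iterD (iter_cancel i gK).
have xj : mdist x (iter (j - i) f x) < mdist x y / 3.
  rewrite -back; apply: NxP => //.
  have := mdist_triangle (iter j g x) p (iter i g x).
  by rewrite (mdist_sym _ p); lra.
have yj : mdist y (iter (j - i) f y) < mdist x y / 3.
  rewrite -back; apply: NyP => //.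
  have := mdist_triangle (iter j g y) q (iter i g y).
  by rewrite (mdist_sym _ q); lra.
have xyj : mdist (iter (j - i) f x) (iter (j - i) f y) < mdist x y / 3.
  exact: N0P.
have := mdist_triangle x (iter (j - i) f x) y.
have := mdist_triangle (iter (j - i) f x) (iter (j - i) f y) y.
by rewrite (mdist_sym (iter (j - i) f y) y); lra.
Qed.
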